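(* Let $H$ be a graph on $h$ vertices with the Erdős–Hajnal property with constant $c_H$. Then for every $0<\varepsilon<1$, every graph $G$ on $n$ vertices contains at least $\varepsilon^{(h-1)/c_H+o(1)}n^h$ induced copies of $H$ or contains an $\varepsilon$-homogeneous set of size at least $\varepsilon^{1/c_H-1+o(1)}n$, where the $o(1)$ terms tend to $0$ as $\varepsilon\to 0$ (and depend only on $H$ and $c_H$, not on $n$ or $G$).
   Context: A set of vertices is homogeneous if it is a clique or an independent set; $\hom(G)$ is the size of a largest homogeneous set in $G$. A graph is $H$-free if it has no induced subgraph isomorphic to $H$. $H$ has the Erdős–Hajnal property with constant $c_H>0$ if every $n$-vertex $H$-free graph $G$ has $\hom(G)\ge n^{c_H}$. A vertex set $S$ is $\varepsilon$-homogeneous if the edge density of $G[S]$ is at most $\varepsilon$ or at least $1-\varepsilon$. *)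

(* Defs.v *)
From HB Require Import structures.
From mathcomp Require Import all_boot all_order all_algebra.
From mathcomp Require Import all_classical all_reals all_analysis.
Set Implicit Arguments.
Unset Strict Implicit.
Unset Printing Implicit Defensive.
Import Order.TTheory GRing.Theory Num.Theory.
Import numFieldNormedType.Exports.
Local Open Scope ring_scope.

Record sgraph := SGraph {
  vertex :> finType;
  adj : rel vertex;
  adj_sym : symmetric adj;
  adj_irr : irreflexive adj
}.

Definition clique (G : sgraph) (S : {set G}) : bool :=
  [forall x in S, forall y in S, (x != y) ==> adj x y].

Definition independent (G : sgraph) (S : {set G}) : bool :=
  [forall x in S, forall y in S, ~~ adj x y].

Definition homogeneous (G : sgraph) (S : {set G}) : bool :=
  clique S || independent S.

Definition hom (G : sgraph) : nat :=
  (\max_(S : {set G} | homogeneous S) #|S|)%N.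

(* G[U] is isomorphic to H. *)
Definition is_induced_copy (H G : sgraph) (U : {set G}) : bool :=
  [exists f : {ffun H -> G},
    [&& injectiveb f,
        [forall x, forall y, adj (f x) (f y) == adj x y]
      & [set f x | x in [set: H]]%SET == U]].

(* Copies are unlabelled: they are counted as vertex sets of G, not as
   embeddings of H. *)
Definition induced_copies (H G : sgraph) : {set {set G}} :=
  [set U : {set G} | is_induced_copy H U]%SET.

Definition induced_free (H G : sgraph) : Prop :=
  forall U : {set G}, ~~ is_induced_copy H U.

Definition EH_property (R : realType) (H : sgraph) (c : R) : Prop :=
  0 < c /\
  forall G : sgraph, induced_free H G -> #|G|%:R `^ c <= (hom G)%:R :> R.

Definition edges_in (G : sgraph) (S : {set G}) : {set {set G}} :=
  [set [set x; y] | x in S, y in S & adj x y]%SET.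

(* For #|S| <= 1 this is 0 / 0 = 0, so such a set is eps-homogeneous for every
   eps >= 0. *)
Definition edge_density (R : realType) (G : sgraph) (S : {set G}) : R :=
  #|edges_in S|%:R / 'C(#|S|, 2)%:R.

Definition eps_homogeneous (R : realType) (G : sgraph) (eps : R)
    (S : {set G}) : Prop :=
  edge_density R S <= eps \/ 1 - eps <= edge_density R S.

(* Main.v *)
Require Import Defs.
From HB Require Import structures.
From mathcomp Require Import all_boot all_order all_algebra.
From mathcomp Require Import all_classical all_reals all_analysis.
From mathcomp Require Import zify ring lra.
Import Order.TTheory GRing.Theory Num.Theory.
Import numFieldNormedType.Exports.
Local Open Scope ring_scope.

(* Sample a random set of [m = eps ^ (- 1 / c - o(1))] vertices.  If [G] has
   fewer than about [n ^ h / m ^ (h - 1)] copies of [H], half of the samples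
   contain at most [m / 2] copies; deleting a vertex from each and applying the
   Erdos-Hajnal property yields a homogeneous set of size
   [k = (m / 2) ^ c = eps ^ (- 1 - o(1))] in the sample.  Hence [G] has at least
   [(n / m) ^ k / 2] homogeneous [k]-sets.  On the other hand, if no set of more
   than [r] vertices is [eps]-homogeneous, every such set has a vertex whose
   (non-)neighbourhood misses a proportion [eps] of it, and a Kleitman-Winston
   count bounds the number of cliques (or independent sets) of size [k] by
   ['C(n, q) * r ^ (k - q) / (k - q)!], where [q] is about
   [ln (1 / eps) / eps], much smaller than [k].  Comparing the two counts gives
   [r >= eps ^ (1 / c - 1 + o(1)) * n].  If [n < m] there is nothing to sample,
   and deleting vertices from [G] itself suffices. *)

(** * Binomial and factorial estimates *)

Lemma bin_le_exp2 (n k : nat) : ('C(n, k) <= 2 ^ n)%N.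
Proof.
elim: n k => [|n IH] [|k] //=; first by rewrite expn_gt0.
by rewrite binS expnS mul2n -addnn leq_add.
Qed.

Lemma bin_mul_trinomial (a k q : nat) : (q <= k)%N ->
  ('C(a, k) * 'C(k, q) = 'C(a, q) * 'C(a - q, k - q))%N.
Proof.
move=> qk; case: (leqP k a) => ka; last first.
  rewrite bin_small // mul0n; case: (leqP q a) => qa.
    by rewrite (@bin_small (a - q)) ?muln0 // ltn_sub2rE.
  by rewrite bin_small.
apply/eqP; rewrite -(eqn_pmul2r (fact_gt0 q)) -(eqn_pmul2r (fact_gt0 (k - q))).
rewrite -(eqn_pmul2r (fact_gt0 (a - k))); apply/eqP.
have e1 := bin_fact ka; have e2 := bin_fact qk.
have e3 := bin_fact (leq_trans qk ka).
have /bin_fact e4 : (k - q <= a - q)%N by rewrite leq_sub2r.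
have e5 : (a - q - (k - q) = a - k)%N by lia.
rewrite e5 in e4; transitivity (a`!)%N.
  by rewrite -e1 -e2; ring.
by rewrite -e3 -e4; ring.
Qed.

(** Choosing a [q]-subset first gives ['C(a, k) <= 'C(a, q) * 'C(a - q, k - q)], and the last factor
    times [(k - q)!] is a falling factorial with [k - q] factors, each at most [a]. *)
Lemma bin_fact_le (a k q : nat) : (q <= k)%N ->
  ('C(a, k) * (k - q)`! <= 'C(a, q) * a ^ (k - q))%N.
Proof.
move=> qk; apply: leq_trans (_ : 'C(a, k) * 'C(k, q) * (k - q)`! <= _)%N.
  by rewrite leq_mul2r leq_pmulr ?bin_gt0 // orbT.
rewrite bin_mul_trinomial // -mulnA bin_ffact leq_mul2l; apply/orP; right.
elim: (k - q)%N => // j IH; rewrite ffactnSr expnSr leq_mul //.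
by rewrite -subnDA leq_subr.
Qed.

(** A crude Stirling bound: [k ^ k] is at most the falling factorial [(2k) ^_ k = 'C(2k, k) * k!],
    and ['C(2k, k) <= 4 ^ k]. *)
Lemma expnn_le_fact (k : nat) : (k ^ k <= 4 ^ k * k`!)%N.
Proof.
have h : forall j, (j <= k)%N -> (k ^ j <= (k + k) ^_ j)%N.
  elim=> // j IH jk; rewrite ffactnSr expnSr leq_mul ?IH //; lia.
apply: leq_trans (h k (leqnn k)) _.
rewrite -bin_ffact leq_mul2r; apply/orP; right.
by rewrite (_ : 4 = 2 ^ 2)%N // -expnM mul2n -addnn bin_le_exp2.
Qed.

(** * Counting the samples that contain a given set *)

(** A random [m]-set contains a given [j]-set with probability at most [(m / n) ^ j], since
    [(m - i) / (n - i) <= m / n]. Choosing the complement, of size [n - m], gives the correct count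
    0 when [j > m], where [m - j] would be truncated. *)
Lemma bin_superset_ratio (n m j : nat) : (j <= n)%N -> (m <= n)%N ->
  ('C(n - j, n - m) * n ^ j <= 'C(n, n - m) * m ^ j)%N.
Proof.
move=> + mn; elim: j => [|j IH] jn; first by rewrite subn0.
rewrite -(leq_pmul2l (_ : 0 < n - j)%N) ?subn_gt0 //.
have e := mul_bin_down (n - j) (n - m).
have e1 : ((n - j).-1 = n - j.+1)%N by lia.
have e2 : (n - j - (n - m) = m - j)%N by lia.
rewrite e1 e2 in e.
have {IH} IH := IH (ltnW jn).
rewrite !expnSr !mulnA e.
have h : ((m - j) * n <= (n - j) * m)%N by nia.
set b := 'C(n - j, n - m) in IH *.
set b' := 'C(n, n - m) in IH *.
rewrite (_ : (m - j) * b * n ^ j * n = ((m - j) * n) * (b * n ^ j))%N; last by ring.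
rewrite (_ : (n - j) * b' * m ^ j * m = ((n - j) * m) * (b' * m ^ j))%N; last by ring.
by rewrite leq_mul.
Qed.

(* Double counting of the pairs [U \subset M] with [U] in the family and
   [#|M| = m]. *)
Lemma sum_card_subsets_le (T : finType) (F : {set {set T}}) (j m : nat) :
  (m <= #|T|)%N -> {in F, forall U : {set T}, #|U| = j} ->
  (#|T| ^ j * \sum_(M : {set T} | #|M| == m) #|[set U in F | U \subset M]%SET|
   <= #|F| * ('C(#|T|, m) * m ^ j))%N.
Proof.
move=> mn Fj.
have -> : (\sum_(M : {set T} | #|M| == m) #|[set U in F | U \subset M]%SET|
  = \sum_(U in F) #|[set M : {set T} | (U \subset M) && (#|M| == m)]%SET|)%N.
  rewrite (eq_bigr (fun M : {set T} => \sum_(U in F | U \subset M) 1)%N); last first.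
    by move=> M _; rewrite -sum1dep_card.
  rewrite (exchange_big_dep (mem F)) /=; last by move=> M U _ /andP[].
  apply: eq_bigr => U UF; rewrite -sum1dep_card; apply: eq_bigl => M.
  by rewrite UF andbC.
rewrite big_distrr -sum_nat_const /=; apply: leq_sum => U UF.
have jn : (j <= #|T|)%N by rewrite -(Fj _ UF) max_card.
(* Complementation turns the [m]-sets above [U] into the subsets of [~: U] of size [#|T| - m]. *)
have -> : #|[set M : {set T} | (U \subset M) && (#|M| == m)]%SET|
    = 'C(#|T| - j, #|T| - m).
  rewrite -(Fj _ UF) (_ : #|T| - #|U| = #|(~: U)%SET|)%N -?cards_draws; last by rewrite [RHS]cardsCs finset.setCK.
  rewrite -(card_imset _ (inv_inj (@finset.setCK T))); apply: eq_card => M.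
  rewrite inE; apply/imsetP/idP => [[N]|].
    rewrite inE => /andP[UN /eqP cN] ->.
    by rewrite finset.setCS UN cardsCs finset.setCK cN eqxx.
  move=> /andP[MU /eqP cM]; exists (~: M)%SET; last by rewrite finset.setCK.
  rewrite inE -finset.setCS finset.setCK MU /=; apply/eqP.
  by have := cardsC M; rewrite cM; lia.
have := @bin_superset_ratio _ m j jn mn.
by rewrite mulnC bin_sub.
Qed.

(** * Kleitman-Winston count *)

(** The relation is arbitrary so that one count serves both cliques and independent sets. *)
Definition pairwise_in {T : finType} (e : rel T) (K : {set T}) :=
  [forall x in K, forall y in K, (x != y) ==> e x y].

Definition ksets_in {T : finType} (e : rel T) (A : {set T}) (k : nat) :=
  [set K : {set T} | [&& K \subset A, #|K| == k & pairwise_in e K]]%SET.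

(** The vertex [v] is removed by hand because non-adjacency is reflexive. *)
Definition nbhd_in {T : finType} (e : rel T) (A : {set T}) (v : T) :=
  [set y in A :\ v | e v y]%SET.

Lemma pairwise_inS (T : finType) (e : rel T) (K L : {set T}) :
  K \subset L -> pairwise_in e L -> pairwise_in e K.
Proof.
move=> /fintype.subsetP KL /forall_inP h; apply/forall_inP => x /KL /h /forall_inP hx.
by apply/forall_inP => y /KL /hx.
Qed.

Lemma card_ksets_in_rec (T : finType) (e : rel T) (A : {set T}) (v : T)
    (k : nat) : v \in A ->
  (#|ksets_in e A k.+1| <= #|ksets_in e (A :\ v) k.+1| + #|ksets_in e (nbhd_in e A v) k|)%N.
Proof.
move=> vA.
apply: (@leq_trans #|ksets_in e (A :\ v) k.+1 :|: [set v |: K | K in ksets_in e (nbhd_in e A v) k]|%SET).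
  apply/subset_leq_card/fintype.subsetP => K.
  rewrite !inE => /and3P[KA /eqP cK pK].
  have [vK|vK] := boolP (v \in K); last by rewrite subsetD1 KA vK cK eqxx pK.
  apply/orP; right; apply/imsetP; exists (K :\ v); last by rewrite finset.setD1K.
  rewrite inE; apply/and3P; split.
  - apply/fintype.subsetP => y; rewrite !inE => /andP[yv yK].
    rewrite yv (fintype.subsetP KA) //=.
    by move/forall_inP: pK => /(_ _ vK) /forall_inP /(_ _ yK); rewrite eq_sym yv.
  - by rewrite (cardsD1 v) vK add1n in cK; case: cK => ->.
  - by apply: pairwise_inS pK; rewrite subsetDl.
apply: leq_trans (leq_card_setU _ _) _.
by rewrite leq_add2l leq_imset_card.
Qed.

(* Split the sets according to whether they contain a vertex [v] of small
   neighbourhood; the two resulting binomials add up by Pascal's rule. *)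
Lemma card_ksets_in_le (R : realFieldType) (T : finType) (e : rel T)
    (b r : R) (q k : nat) (A : {set T}) :
  0 <= b ->
  (forall B : {set T}, r < #|B|%:R ->
     exists2 v, v \in B & #|nbhd_in e B v|%:R <= b * #|B|%:R) ->
  (q <= k)%N -> b ^+ q * #|A|%:R <= r ->
  #|ksets_in e A k|%:R * (k - q)`!%:R <= 'C(#|A|, q)%:R * r ^+ (k - q).
Proof.
move=> b0 hv; have [s] := ubnP #|A|; elim: s q k A => // s IH q k A As qk hr.
have r0 : 0 <= r by apply: le_trans hr; rewrite mulr_ge0 ?exprn_ge0.
have [Ar|Ar] := leP #|A|%:R r.
  have hA : (#|ksets_in e A k| <= 'C(#|A|, k))%N.
    by rewrite -cards_draws subset_leq_card //; apply/fintype.subsetP => K;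
      rewrite !inE => /and3P[-> ->].
  apply: le_trans (_ : 'C(#|A|, q)%:R * #|A|%:R ^+ (k - q) <= _).
    rewrite -natrM -natrX -natrM ler_nat.
    by apply: leq_trans (bin_fact_le _ _ _ qk); rewrite leq_mul2r hA orbT.
  by rewrite ler_wpM2l // lerXn2r ?nnegrE.
(* The exponent [q] is a budget of steps into a neighbourhood; it cannot be exhausted while [A] has
   more than [r] elements. *)
case: q qk hr => [|q] qk hr; first by move: hr; rewrite expr0 mul1r leNgt Ar.
case: k qk => // k qk.
have [v vA hN] := hv _ Ar.
have cA : #|A| = #|A :\ v|.+1 by rewrite (cardsD1 v) vA.
have h1 := IH q.+1 k.+1 (A :\ v).
have h2 := IH q k (nbhd_in e A v).
have Avs : (#|A :\ v| < s)%N by move: As; rewrite cA.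
have NA : (#|nbhd_in e A v| <= #|A :\ v|)%N.
  by rewrite subset_leq_card //; apply/fintype.subsetP => y; rewrite inE => /andP[].
have {}h1 : #|ksets_in e (A :\ v) k.+1|%:R * (k - q)`!%:R
    <= 'C(#|A :\ v|, q.+1)%:R * r ^+ (k - q).
  apply: h1 => //; apply: le_trans hr; rewrite ler_wpM2l ?exprn_ge0 //.
  by rewrite ler_nat cA.
have {}h2 : #|ksets_in e (nbhd_in e A v) k|%:R * (k - q)`!%:R
    <= 'C(#|A :\ v|, q)%:R * r ^+ (k - q).
  apply: le_trans (_ : 'C(#|nbhd_in e A v|, q)%:R * r ^+ (k - q) <= _).
    apply: h2 => //; first exact: leq_ltn_trans NA Avs.
    (* The neighbourhood is smaller by the factor [b], which pays for lowering [q] by one. *)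
    apply: le_trans hr; rewrite exprSr -mulrA ler_wpM2l ?exprn_ge0 //.
  by rewrite ler_wpM2r ?exprn_ge0 // ler_nat leq_bin2l.
rewrite subSS cA binS natrD mulrDl.
apply: le_trans (lerD h1 h2).
rewrite -mulrDl ler_wpM2r // -natrD ler_nat.
exact: card_ksets_in_rec.
Qed.

(** * Degrees and homogeneous sets *)

Definition nonadj {G : sgraph} (x y : G) := ~~ adj x y.

(** Handshake lemma: the ordered adjacent pairs map two-to-one onto the edges. *)
Lemma card_nbhd_in_adj (G : sgraph) (S : {set G}) :
  (\sum_(v in S) #|nbhd_in (@adj G) S v| = 2 * #|edges_in S|)%N.
Proof.
set D := [set p : G * G | [&& p.1 \in S, p.2 \in S & adj p.1 p.2]]%SET.
have -> : edges_in S = [set [set p.1; p.2] | p in D]%SET.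
  apply/setP => e; apply/imset2P/imsetP => [[x y xS]|[[x y]]].
    rewrite inE => /andP[yS xy] ->; exists (x, y) => //.
    by rewrite inE /= xS yS xy.
  rewrite inE /= => /and3P[xS yS xy] ->.
  by exists x y => //; rewrite inE yS xy.
have -> : (\sum_(v in S) #|nbhd_in (@adj G) S v| = #|D|)%N.
  rewrite (eq_bigr (fun v => \sum_(y | (y \in S) && adj v y) 1)%N); last first.
    move=> v vS; rewrite -sum1_card; apply: eq_bigl => y; rewrite !inE.
    by case: eqVneq => //= ->; rewrite adj_irr andbF.
  rewrite pair_big_dep -sum1_card; apply: eq_bigl => -[x y].
  by rewrite !inE.
rewrite -sum1_card (partition_big_imset (fun p : G * G => [set p.1; p.2]%SET)) /=.
rewrite mulnC -sum_nat_const; apply: eq_bigr => e /imsetP[[a b]].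
rewrite inE /= => /and3P[aS bS ab] ->.
have nab : a != b by apply: contraTneq ab => ->; rewrite adj_irr.
rewrite sum1dep_card (_ : [set _ | _]%SET = [set (a, b); (b, a)]%SET).
  by rewrite cards2 xpair_eqE negb_and nab.
apply/setP => -[x y]; rewrite !inE /= !xpair_eqE.
apply/idP/idP.
  move=> /andP[/and3P[_ _ xy] /eqP E].
  have nxy : x != y by apply: contraTneq xy => ->; rewrite adj_irr.
  have : x \in [set a; b]%SET by rewrite -E !inE eqxx.
  have : y \in [set a; b]%SET by rewrite -E !inE eqxx orbT.
  rewrite !inE => /orP[] /eqP ye /orP[] /eqP xe; move: nxy;
    by rewrite xe ye ?eqxx ?orbT.
move=> /orP[] /andP[/eqP-> /eqP->]; first by rewrite aS bS ab eqxx.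
by rewrite aS bS adj_sym ab finset.setUC eqxx.
Qed.

(** The average degree is the density times [#|S| - 1], and the density lies strictly between [eps]
    and [1 - eps]. So neither all degrees nor all co-degrees can exceed [(1 - eps) * (#|S| - 1)]. *)
Lemma not_eps_homogeneous (R : realType) (G : sgraph) (eps : R) (S : {set G}) :
  0 <= eps -> ~ eps_homogeneous eps S ->
  [/\ (1 < #|S|)%N,
      exists2 v, v \in S & #|nbhd_in (@nonadj G) S v|%:R <= (1 - eps) * (#|S|%:R - 1)
    & exists2 v, v \in S & #|nbhd_in (@adj G) S v|%:R <= (1 - eps) * (#|S|%:R - 1)].
Proof.
move=> e0 nh.
have [h1 h2] : eps < edge_density R S /\ edge_density R S < 1 - eps.
  by split; rewrite ltNge; apply/negP => h; apply: nh; [left|right].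
(* For at most one vertex the density is [0 / 0 = 0], hence at most [eps]. *)
have s1 : (1 < #|S|)%N.
  rewrite ltnNge; apply/negP => s1; move: h1; rewrite /edge_density.
  by rewrite bin_small // invr0 mulr0 ltNge e0.
have s1' : 1 < #|S|%:R :> R by rewrite ltr1n.
have bE : 'C(#|S|, 2)%:R = #|S|%:R * (#|S|%:R - 1) / 2 :> R.
  have : ('C(#|S|, 2) * 2 = #|S| * #|S|.-1)%N by rewrite (bin_ffact _ 2) !ffactnS muln1.
  move/(congr1 (fun x => x%:R : R)); rewrite !natrM -subn1 natrB ?(ltnW s1) // => <-.
  by rewrite mulfK.
have sum_deg : \sum_(v in S) #|nbhd_in (@adj G) S v|%:R = 2 * #|edges_in S|%:R :> R.
  by rewrite -natr_sum card_nbhd_in_adj natrM.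
have codeg v : v \in S ->
    #|nbhd_in (@nonadj G) S v|%:R = #|S|%:R - 1 - #|nbhd_in (@adj G) S v|%:R :> R.
  move=> vS; rewrite (cardsD1 v S) vS natrD [1 + _]addrC addrK.
  rewrite -(cardsID [set y | adj v y]%SET (S :\ v)%SET) natrD [X in X - _]addrC.
  rewrite (_ : ((S :\ v) :&: [set y | adj v y])%SET = nbhd_in (@adj G) S v).
    rewrite addrK; congr (#|pred_of_set _|%:R).
    by apply/setP => y; rewrite !inE /nonadj andbC.
  by apply/setP => y; rewrite !inE.
have avg (F : G -> R) (b : R) : (forall v, v \in S -> F v <= b) ->
    \sum_(v in S) F v <= #|S|%:R * b.
  move=> hF; apply: le_trans (ler_sum _ hF) _.
  by rewrite sumr_const mulr_natl.
move: h1 h2; rewrite /edge_density bE.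
have p0 : 0 < #|S|%:R * (#|S|%:R - 1) / 2 :> R by nra.
rewrite ltr_pdivlMr // ltr_pdivrMr // => h1 h2.
split => //.
  apply: contrapT => hv.
  have /avg : forall v, v \in S -> #|nbhd_in (@adj G) S v|%:R <= eps * (#|S|%:R - 1).
    move=> v vS; rewrite leNgt; apply/negP => h; apply: hv; exists v => //.
    by rewrite codeg //; lra.
  by rewrite sum_deg; lra.
apply: contrapT => hv.
have /avg : forall v, v \in S -> - #|nbhd_in (@adj G) S v|%:R <= - ((1 - eps) * (#|S|%:R - 1)).
  move=> v vS; rewrite lerN2 leNgt; apply/negP => h; apply: hv; exists v => //.
  exact: ltW.
by rewrite sumrN sum_deg; lra.
Qed.

Lemma independentE (G : sgraph) (S : {set G}) :
  independent S = pairwise_in (@nonadj G) S.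
Proof.
apply: eq_forallb => x; case: (x \in S) => //=.
apply: eq_forallb => y; case: (y \in S) => //=.
by case: eqVneq => //= ->; rewrite adj_irr.
Qed.

Lemma homogeneousE (G : sgraph) (S : {set G}) :
  homogeneous S = pairwise_in (@adj G) S || pairwise_in (@nonadj G) S.
Proof. by rewrite /homogeneous independentE. Qed.

Lemma homogeneousS (G : sgraph) (S T : {set G}) :
  S \subset T -> homogeneous T -> homogeneous S.
Proof.
by rewrite !homogeneousE => ST /orP[] /(pairwise_inS _ _ _ _ ST) ->; rewrite ?orbT.
Qed.

(** Otherwise some vertex would miss a proportion [eps] of the others, in either relation, whereas
    in a homogeneous set one of the two relations joins every vertex to all others. *)
Lemma homogeneous_eps_homogeneous (R : realType) (G : sgraph) (eps : R)
    (S : {set G}) : 0 < eps -> homogeneous S -> eps_homogeneous eps S.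
Proof.
move=> e0 hS; apply: contrapT => /(not_eps_homogeneous _ _ _ _ (ltW e0)) [s1 h1 h2].
have contra (e : rel G) : pairwise_in e S ->
    (exists2 v, v \in S & #|nbhd_in e S v|%:R <= (1 - eps) * (#|S|%:R - 1)) -> False.
  move=> /forall_inP pS [v vS].
  have -> : nbhd_in e S v = (S :\ v)%SET.
    apply/setP => y; rewrite !inE; case: eqVneq => //= yv.
    case: (boolP (y \in S)) => //= yS.
    by have /forall_inP/(_ _ yS) := pS _ vS; rewrite eq_sym yv.
  have s1' : 1 < #|S|%:R :> R by rewrite ltr1n.
  have : #|S|%:R = 1 + #|(S :\ v)%SET|%:R :> R by rewrite (cardsD1 v S) vS natrD.
  nra.
by move: hS; rewrite homogeneousE => /orP[] /contra; auto.
Qed.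

(** * The Erdos-Hajnal property inside vertex subsets *)

Definition induced_subgraph (G : sgraph) (A : {set G}) : sgraph :=
  @SGraph {x : G | x \in A} (fun x y => adj (val x) (val y))
    (fun x y => adj_sym (val x) (val y)) (fun x => adj_irr (val x)).

Lemma is_induced_copyP (H G : sgraph) (U : {set G}) :
  reflect (exists f : H -> G, [/\ injective f,
      forall x y, adj (f x) (f y) = adj x y & U = [set f x | x in [set: H]]%SET])
    (is_induced_copy H U).
Proof.
apply: (iffP existsP) => [[f /and3P[/injectiveP fi /forallP fa /eqP <-]]|[f [fi fa ->]]].
  exists f; split => // x y; apply/eqP; exact: (forallP (fa x)).
exists [ffun x => f x]; apply/and3P; split.
- by apply/injectiveP => x y; rewrite !ffunE => /fi.
- by apply/forallP => x; apply/forallP => y; rewrite !ffunE fa.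
- by apply/eqP/setP => u; apply/imsetP/imsetP => -[x xH ->]; exists x; rewrite ?ffunE.
Qed.

Lemma card_induced_copy (H G : sgraph) (U : {set G}) :
  U \in induced_copies H G -> #|U| = #|H|.
Proof.
by rewrite inE => /is_induced_copyP[f [fi _ ->]]; rewrite card_imset ?cardsT.
Qed.

Lemma EH_homogeneous_subset (R : realType) (H : sgraph) (c : R) (G : sgraph)
    (A : {set G}) : EH_property H c ->
  {in induced_copies H G, forall U : {set G}, ~~ (U \subset A)} ->
  exists S : {set G}, [/\ S \subset A, homogeneous S & #|A|%:R `^ c <= #|S|%:R].
Proof.
move=> [c0 EH] noA.
have free : induced_free H (induced_subgraph G A).
  move=> U; apply/negP => /is_induced_copyP[f [fi fa _]].
  have /noA/negP[] : [set val (f x) | x in [set: H]]%SET \in induced_copies H G.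
    rewrite inE; apply/is_induced_copyP; exists (val \o f); split => //.
    exact: inj_comp val_inj fi.
  by apply/fintype.subsetP => _ /imsetP[x _ ->]; exact: valP.
have := EH _ free; rewrite card_sig.
have [S hS ->] : {S : {set induced_subgraph G A} |
    homogeneous S & Defs.hom (induced_subgraph G A) = #|S|}.
  apply: (eq_bigmax_cond (fun S : {set _} => #|S|)); apply/card_gt0P; exists finset.set0.
  by apply/orP; left; apply/forall_inP => x; rewrite inE.
rewrite (eq_card (_ : _ =i A)) // => hA.
exists [set val x | x in S]%SET; split.
- by apply/fintype.subsetP => _ /imsetP[x _ ->]; exact: valP.
- case/orP: hS => /forall_inP hS; apply/orP; [left|right];
    apply/forall_inP => _ /imsetP[x xS ->]; apply/forall_inP => _ /imsetP[y yS ->].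
    by rewrite (inj_eq val_inj); exact: (forall_inP (hS _ xS)).
  exact: (forall_inP (hS _ xS)).
- by rewrite card_imset //; exact: val_inj.
Qed.

Definition copies_in (H : sgraph) {G : sgraph} (M : {set G}) :=
  [set U in induced_copies H G | U \subset M]%SET.

(** Deleting one vertex from each copy inside [M] destroys them all. If there are more copies than
    vertices, the truncated difference makes the bound trivial. *)
Lemma few_copies_homogeneous (R : realType) (H : sgraph) (c : R) (G : sgraph)
    (M : {set G}) : (0 < #|H|)%N -> EH_property H c ->
  exists S : {set G}, [/\ S \subset M, homogeneous S
    & (#|M| - #|copies_in H M|)%:R `^ c <= #|S|%:R].
Proof.
move=> H0 EH.
have /card_gt0P[x0 _] := H0.
case: (pickP (mem M)) => [g0 _|M0]; last first.
  exists finset.set0; split; first exact: finset.sub0set.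
    by apply/orP; left; apply/forall_inP => x; rewrite inE.
  rewrite (eq_card0 M0) sub0n cards0 powR0 //.
  by case: EH => c0 _; rewrite gt_eqF.
(* The default [g0] is never picked from a copy, because [H] and hence each copy is nonempty. *)
pose pk (U : {set G}) := odflt g0 [pick x in U].
set D := [set pk U | U in copies_in H M]%SET.
have [|S [SA hS hc]] := EH_homogeneous_subset R H c G (M :\: D)%SET EH.
  move=> U UH; apply/negP => /fintype.subsetP UM.
  have UcM : U \in copies_in H M.
    rewrite inE UH; apply/fintype.subsetP => x /UM; rewrite inE.
    by case/andP.
  have : pk U \in U.
    rewrite /pk; case: pickP => //= U0.
    by move: H0; rewrite -(card_induced_copy _ _ _ UH) (eq_card0 U0).
  by move/UM; rewrite inE imset_f.
exists S; split => //; first by apply: fintype.subset_trans SA (finset.subsetDl _ _).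
apply: le_trans hc; case: EH => c0 _.
apply: ge0_ler_powR; rewrite ?nnegrE ?ler0n ?(ltW c0) // ler_nat.
rewrite cardsD leq_sub2l //; apply: leq_trans (_ : #|D| <= _)%N.
  by rewrite subset_leq_card // subsetIr.
exact: leq_imset_card.
Qed.

(** * Lower and upper counts of homogeneous [k]-sets *)

Lemma card_homogeneous_ksets (R : realType) (H : sgraph) (c : R) (G : sgraph)
    (m k : nat) : (0 < #|H|)%N -> EH_property H c ->
  (0 < m <= #|G|)%N ->
  (4 * (#|induced_copies H G| * m ^ #|H|.-1) <= #|G| ^ #|H|)%N ->
  k%:R <= (m%:R / 2) `^ c ->
  (#|G| ^ k <= 2 * (#|[set K : {set G} | (#|K| == k) && homogeneous K]%SET|
                    * m ^ k))%N.
Proof.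
move=> H0 EH /andP[m0 mn] hN hk.
set n := #|G| in mn hN *; set h := #|H| in H0 hN.
set N := #|induced_copies H G| in hN.
set F := [set K : {set G} | _]%SET.
have C0 : (0 < 'C(n, m))%N by rewrite bin_gt0.
pose bad := [set M : {set G} | (#|M| == m) && (m < 2 * #|copies_in H M|)%N]%SET.
have n0 : (0 < n)%N by apply: leq_trans mn.
(* Markov's inequality: a sample contains on average at most [N * (m / n) ^ h <= m / 4] copies, and
   a bad one more than [m / 2]. *)
have bad_le : (2 * #|bad| <= 'C(n, m))%N.
  have dc := sum_card_subsets_le G (induced_copies H G) h m mn
    (fun U => card_induced_copy H G U).
  have hb : (#|bad| * m <= 2 * \sum_(M : {set G} | #|M| == m) #|copies_in H M|)%N.
    rewrite -sum_nat_const big_distrr /= [X in (_ <= X)%N](bigID (fun M => M \in bad)) /=.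
    apply: leq_trans (leq_addr _ _).
    rewrite [X in (_ <= X)%N](eq_bigl (mem bad)); last first.
      by move=> M; rewrite !inE; case: (_ == _).
    by apply: leq_sum => M; rewrite inE => /andP[_ /ltnW].
  have mh : (m ^ h = m * m ^ h.-1)%N by rewrite -expnS prednK.
  rewrite mh in dc.
  have nh : (0 < n ^ h)%N by rewrite expn_gt0 n0.
  rewrite -(leq_pmul2r m0) -(leq_pmul2r nh).
  move: dc; rewrite -/n; set Sg := (\sum_(M | _) _)%N => dc.
  have {}hb : (#|bad| * m <= 2 * Sg)%N by [].
  have e1 : (2 * #|bad| * m * n ^ h <= 4 * (n ^ h * Sg))%N.
    by rewrite -mulnA -mulnA (mulnA #|bad|) (mulnC _ (n ^ h)%N); nia.
  apply: (leq_trans e1).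
  apply: (@leq_trans (4 * (N * ('C(n, m) * (m * m ^ h.-1))))); first by rewrite leq_mul2l.
  rewrite (_ : 4 * (N * ('C(n, m) * (m * m ^ h.-1))) = 'C(n, m) * m * (4 * (N * m ^ h.-1)))%N.
    by rewrite leq_mul2l hN orbT.
  by ring.
(* Every sample that is not bad contains a member of [F]: after the deletion at least [m / 2]
   vertices remain. *)
have F_ge : ('C(n, m) <= #|bad| + \sum_(M : {set G} | #|M| == m) #|[set K in F | K \subset M]%SET|)%N.
  rewrite -card_draws -(cardsID bad [set M : {set G} | #|M| == m]%SET) leq_add //.
    by rewrite subset_leq_card // finset.subsetIr.
  rewrite -sum1_card.
  rewrite [X in (_ <= X)%N](bigID (fun M => M \notin bad)) /=.
  apply: leq_trans (leq_addr _ _).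
  rewrite (eq_bigl (fun M : {set G} => (#|M| == m) && (M \notin bad))); last first.
    by move=> M; rewrite finset.in_setD [X in _ && X]inE andbC.
  apply: leq_sum => M /andP[/eqP cM]; rewrite inE cM eqxx /= -leqNgt => few.
  have [S [SM hS cS]] := few_copies_homogeneous R H c G M H0 EH.
  have kS : (k <= #|S|)%N.
    rewrite -(ler_nat R); apply: le_trans cS; apply: (le_trans hk).
    have c0 : 0 < c by case: EH.
    apply: ge0_ler_powR; rewrite ?nnegrE ?divr_ge0 ?(ltW c0) //.
    rewrite cM ler_pdivrMr // -[2]/(2%:R) -natrM ler_nat; move: few; set x := #|_|; lia.
  have [K] : {K : {set G} | K \subset S & #|K| == k}.
    have /card_gt0P/sigW [K] : (0 < #|[set K : {set G} | K \subset S & #|K| == k]%SET|)%N.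
      by rewrite cards_draws bin_gt0.
    by rewrite inE => /andP[KS cK]; exists K.
  move=> KS cK; apply/card_gt0P; exists K; rewrite !inE cK.
  by rewrite (homogeneousS _ _ _ KS hS) (fintype.subset_trans KS SM).
have Fk : {in F, forall K : {set G}, #|K| = k}.
  by move=> K; rewrite inE => /andP[/eqP].
have := sum_card_subsets_le G F k m mn Fk; rewrite -/n => dc.
rewrite -(leq_pmul2r C0).
move: F_ge dc; set Sg := (\sum_(M | _) _)%N => F_ge dc.
have h1 : ('C(n, m) <= 2 * Sg)%N by lia.
apply: (@leq_trans (2 * (n ^ k * Sg))); first by rewrite mulnCA leq_mul2l h1 orbT.
rewrite (_ : 2 * (#|F| * m ^ k) * 'C(n, m) = 2 * (#|F| * ('C(n, m) * m ^ k)))%N; last by ring.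
by rewrite leq_mul2l.
Qed.

(** The two counts are compared, and ['C(n, q) <= n ^ q / q!] cancels every power of [n]. The factor
    4 comes from the half lost to bad samples and from treating cliques and independent sets
    separately; 8 is [4 * 2], from [k ^ k <= 4 ^ k * k!] and ['C(k, q) <= 2 ^ k]. *)
Lemma no_large_eps_homogeneous_bound (R : realType) (H : sgraph) (c eps rho : R)
    (G : sgraph) (m k q : nat) : (0 < #|H|)%N -> EH_property H c ->
  (0 < m <= #|G|)%N ->
  (4 * (#|induced_copies H G| * m ^ #|H|.-1) <= #|G| ^ #|H|)%N ->
  k%:R <= (m%:R / 2) `^ c -> (q <= k)%N ->
  0 < eps < 1 -> (1 - eps) ^+ q <= rho ->
  (forall S : {set G}, rho * #|G|%:R < #|S|%:R -> ~ eps_homogeneous eps S) ->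
  k%:R ^+ k <= 4 * 8 ^+ k * m%:R ^+ k * rho ^+ (k - q).
Proof.
move=> H0 EH mn hN hk qk /andP[e0 e1] hq hS.
have := card_homogeneous_ksets R H c G m k H0 EH mn hN hk.
set F := [set K : {set G} | _]%SET => hF.
have n0 : (0 < #|G|)%N by case/andP: mn => m0; apply: leq_trans.
set n := #|G| in hF n0 hS *.
have b0 : 0 <= 1 - eps by lra.
have rho0 : 0 <= rho by apply: le_trans hq; rewrite exprn_ge0.
have nR : 0 < n%:R :> R by rewrite ltr0n.
have KW (e : rel G) :
    (forall S : {set G}, ~ eps_homogeneous eps S ->
      exists2 v, v \in S & #|nbhd_in e S v|%:R <= (1 - eps) * (#|S|%:R - 1)) ->
    #|ksets_in e finset.setT k|%:R * (k - q)`!%:R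
      <= 'C(n, q)%:R * (rho * n%:R) ^+ (k - q).
  move=> he; rewrite -[n in 'C(n, _)](cardsT G).
  (* The count starts from all vertices, with [b = 1 - eps] and [r = rho * n]. *)
  apply: (card_ksets_in_le _ _ e (1 - eps)) => //.
    move=> B /hS /he [v vB hv]; exists v => //; apply: (le_trans hv).
    by rewrite ler_wpM2l //; lra.
  by rewrite cardsT ler_wpM2r.
have KWa := KW (@adj G) (fun S h =>
  let: And3 _ _ h' := not_eps_homogeneous R G eps S (ltW e0) h in h').
have KWn := KW (@nonadj G) (fun S h =>
  let: And3 _ h' _ := not_eps_homogeneous R G eps S (ltW e0) h in h').
have FU : (#|F| <= #|ksets_in (@adj G) finset.setT k| + #|ksets_in (@nonadj G) finset.setT k|)%N.
  apply: leq_trans (leq_card_setU _ _); rewrite subset_leq_card //.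
  apply/fintype.subsetP => K; rewrite !inE homogeneousE finset.subsetT /=.
  by case: (_ == _).
have FR : #|F|%:R * (k - q)`!%:R <= 2 * ('C(n, q)%:R * (rho * n%:R) ^+ (k - q)) :> R.
  apply: le_trans (_ : (#|ksets_in (@adj G) finset.setT k| + #|ksets_in (@nonadj G) finset.setT k|)%:R * (k - q)`!%:R <= _).
    by rewrite ler_wpM2r // ler_nat.
  by rewrite natrD mulrDl; lra.
have hFR : n%:R ^+ k <= 2 * (#|F|%:R * m%:R ^+ k) :> R.
  by rewrite -!natrX -!natrM ler_nat.
have qfact : 'C(n, q)%:R * q`!%:R <= n%:R ^+ q :> R.
  rewrite -natrM -natrX ler_nat.
  by have := bin_fact_le n q 0 (leq0n q); rewrite subn0 bin0 mul1n.
have h1 : (k - q)`!%:R * q`!%:R <= 4 * m%:R ^+ k * rho ^+ (k - q) :> R.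
  rewrite -(ler_pM2l (exprn_gt0 k nR)).
  apply: le_trans (_ : 2 * (#|F|%:R * m%:R ^+ k) * ((k - q)`!%:R * q`!%:R) <= _).
    by rewrite ler_wpM2r ?mulr_ge0.
  rewrite (_ : 2 * (#|F|%:R * m%:R ^+ k) * ((k - q)`!%:R * q`!%:R)
    = 2 * m%:R ^+ k * q`!%:R * (#|F|%:R * (k - q)`!%:R)); last by ring.
  apply: le_trans (_ : 2 * m%:R ^+ k * q`!%:R * (2 * ('C(n, q)%:R * (rho * n%:R) ^+ (k - q))) <= _).
    by rewrite ler_wpM2l // !mulr_ge0 ?exprn_ge0.
  rewrite exprMn (_ : n%:R ^+ k = n%:R ^+ q * n%:R ^+ (k - q)); last by rewrite -exprD subnKC.
  rewrite (_ : 2 * m%:R ^+ k * q`!%:R * (2 * ('C(n, q)%:R * (rho ^+ (k - q) * n%:R ^+ (k - q))))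
    = 4 * m%:R ^+ k * rho ^+ (k - q) * n%:R ^+ (k - q) * ('C(n, q)%:R * q`!%:R)); last by ring.
  rewrite (_ : n%:R ^+ q * n%:R ^+ (k - q) * (4 * m%:R ^+ k * rho ^+ (k - q))
    = 4 * m%:R ^+ k * rho ^+ (k - q) * n%:R ^+ (k - q) * n%:R ^+ q); last by ring.
  by rewrite ler_wpM2l // !mulr_ge0 ?exprn_ge0.
have kf : k`!%:R = 'C(k, q)%:R * ((k - q)`!%:R * q`!%:R) :> R.
  by rewrite -!natrM [((k - q)`! * _)%N]mulnC bin_fact.
apply: le_trans (_ : 4 ^+ k * k`!%:R <= _).
  by rewrite -!natrX -natrM ler_nat expnn_le_fact.
rewrite (_ : 8 = 4 * 2 :> R); last by ring.
rewrite exprMn kf.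
rewrite (_ : 4 * (4 ^+ k * 2 ^+ k) * m%:R ^+ k * rho ^+ (k - q)
  = 4 ^+ k * (2 ^+ k * (4 * m%:R ^+ k * rho ^+ (k - q)))); last by ring.
rewrite ler_wpM2l ?exprn_ge0 // ler_pM ?mulr_ge0 //.
by rewrite -natrX ler_nat bin_le_exp2.
Qed.

(** * Choice of the parameters *)

(** For [t >= 1] and [a ^ 2 * t >= 8 * |C|], the square of [a * t / 2 <= expR (a * t / 2)] is at
    least [2 * |C| * t]. *)
Lemma linear_le_expR (R : realType) (a C : R) : 0 < a ->
  exists t0 : R, forall t, t0 <= t -> C * (1 + t) <= expR (a * t).
Proof.
move=> a0; exists (1 + `|C| * 8 / a ^+ 2) => t ht.
have d0 : 0 <= `|C| * 8 / a ^+ 2 by rewrite divr_ge0 ?mulr_ge0 ?exprn_ge0 ?(ltW a0).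
have hat : `|C| * 8 <= a ^+ 2 * t.
  rewrite -ler_pdivrMl ?exprn_gt0 // mulrC; lra.
have t1 : 1 <= t by lra.
have -> : a * t = a * t / 2 + a * t / 2 by field.
rewrite expRD; have h := expR_ge1Dx (a * t / 2).
have u0 : 0 <= a * t / 2 by nra.
apply: le_trans (_ : (a * t / 2) * (a * t / 2) <= _); last by rewrite ler_pM //; lra.
apply: le_trans (_ : `|C| * (1 + t) <= _).
  by rewrite ler_wpM2r ?ler_norm //; lra.
have C0 := normr_ge0 C.
have : `|C| * 8 * t <= a ^+ 2 * t * t by rewrite ler_wpM2r //; lra.
rewrite expr2; nra.
Qed.

Lemma truncn_bounds (R : realType) (x : R) : 1 <= x ->
  [/\ (0 < Num.truncn x)%N, (Num.truncn x)%:R <= x & x / 2 <= (Num.truncn x)%:R].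
Proof.
move=> x1; have x0 : 0 <= x by lra.
have /andP[h1 h2] := truncn_itv x0.
have m0 : (0 < Num.truncn x)%N by rewrite truncn_gt0.
have : 1 <= (Num.truncn x)%:R :> R by rewrite ler1n.
by move: h2; rewrite -natr1 => h2 m1; split => //; lra.
Qed.

(* The parameters of the sampling argument at [eps = expR (- t)]: up to an
   exponent that is a small multiple of [d], [m] is [eps ^ (- 1 / c)], [k] is
   [1 / eps] and [q] is [ln (1 / eps) / eps]. *)
Lemma sampling_parameters (R : realType) (c d : R) (h : nat) :
  0 < c <= 1 -> 0 < d -> (0 < h)%N ->
  exists t0 : R, forall t, t0 <= t ->
    let rho := expR (- ((1 / c - 1 + d) * t)) in
    exists m k q : nat,
      [/\ (0 < m)%N, k%:R <= (m%:R / 2) `^ c & (q <= k)%N] /\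
      [/\ (1 - expR (- t)) ^+ q <= rho,
          4 * (expR (- (((h%:R - 1) / c + d) * t)) * m%:R ^+ h.-1) <= 1,
          4 * 8 ^+ k * m%:R ^+ k * rho ^+ (k - q) < k%:R ^+ k
        & forall n : nat, (0 < n <= m)%N -> rho * n%:R <= (n%:R / 2) `^ c].
Proof.
move=> /andP[c0 c1] d0 h0.
have hR : 1 <= h%:R :> R by rewrite ler1n.
(* The extra exponent [d1] of the sample size costs at most [d / 4] after raising to the power
   [h - 1]. *)
set B := 1 / c - 1; set d1 := d / (4 * h%:R).
have B0 : 0 <= B by rewrite subr_ge0 ler_pdivlMr // mul1r.
have d10 : 0 < d1 by rewrite divr_gt0 //; lra.
have d1h : d1 * h%:R = d / 4 by rewrite /d1; field; rewrite pnatr_eq0 -lt0n h0.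
have d1d : d1 <= d / 4 by rewrite -d1h; nra.
have cd1 : 0 < c * d1 by rewrite mulr_gt0.
have cB : c * (1 / c + d1) = 1 + c * d1 by field; rewrite gt_eqF.
have [t1 ht1] := linear_le_expR R (c * d1) (32 / d * ((B + d) * (B + d + 1))) cd1.
have d20 : 0 < d / 2 by lra.
have [t2 ht2] := linear_le_expR R (d / 2) 257 d20.
exists (Num.max (Num.max t1 t2) 3) => t.
rewrite !ge_max => /andP[/andP[/ht1 e1 /ht2 e2]] t3 rho.
have {}e2 : 256 < expR (d / 2 * t) by nra.
(* [X] is [m] before rounding and [Z = X ^ c] is the target for [k]. Halving [m] and two roundings
   lose at most a factor 8, as [c <= 1]. *)
pose X := expR ((1 / c + d1) * t); pose Z := expR ((1 + c * d1) * t).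
have ic : 1 <= 1 / c by rewrite ler_pdivlMr // mul1r.
have X1 : 1 <= X by apply: le_trans (expR_ge1Dx _); nra.
have [m0 mX Xm] := truncn_bounds _ _ X1; set m := Num.truncn X in m0 mX Xm.
pose Y := (m%:R / 2 : R) `^ c.
have ZX : Z = X `^ c by rewrite /X /Z -expRM -cB; congr expR; ring.
have half_le (x y : R) : 0 < y <= 1 -> 0 <= x -> x `^ c * y <= (x * y) `^ c.
  move=> /andP[y0 y1] x0; rewrite powRM ?(ltW y0) // ler_wpM2l ?powR_ge0 //.
  by apply: ger1_powR; rewrite ?y0.
have YZ : Z / 4 <= Y.
  rewrite ZX; apply: le_trans (half_le _ _ _ _) _; first by apply/andP; split; lra.
    by lra.
  by apply: ge0_ler_powR; rewrite ?nnegrE ?(ltW c0) //; lra.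
have Zt : expR t <= Z by rewrite /Z ler_expR; nra.
have Z4 : 4 <= Z by apply: le_trans Zt; have := expR_ge1Dx t; lra.
have Y1 : 1 <= Y by lra.
have [k0 kY Yk] := truncn_bounds _ _ Y1; set k := Num.truncn Y in k0 kY Yk.
have Zk : Z / 8 <= k%:R by lra.
have W1 : 1 <= (B + d) * t * expR t + 1.
  by rewrite lerDr !mulr_ge0 ?expR_ge0 //; lra.
have qp : 0 <= (B + d) * t * expR t + 1 by lra.
(* The added 1 keeps [q] above [(B + d) * t * expR t] after truncation, as
   [(1 - eps) ^ q <= expR (- eps * q) <= rho] requires. *)
have /andP[qle qlt] := truncn_itv qp; set q := Num.truncn _ in qle qlt.
have {}qlt : (B + d) * t * expR t <= q%:R by move: qlt; rewrite -natr1; lra.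
have et1 : 1 <= expR t by have := expR_ge1Dx t; lra.
(* Up to constants, [k] exceeds [expR t] by an exponential factor and [q] only by a linear one.
   Hence replacing [k] by [k - q] in the exponent of [rho] costs at most [d / 4]. *)
have qk' : (B + d) * q%:R <= d / 4 * k%:R.
  have f1 : (B + d) * q%:R <= (B + d) * (((B + d) * t + 1) * expR t).
    by rewrite ler_wpM2l //; lra.
  have f2 : d / 4 * (Z / 8) <= d / 4 * k%:R by rewrite ler_wpM2l //; lra.
  have ZE : Z = expR t * expR (c * d1 * t) by rewrite -expRD /Z; congr expR; ring.
  apply: le_trans f1 (le_trans _ f2); rewrite ZE.
  have f3 : (B + d) * ((B + d) * t + 1) <= d / 32 * expR (c * d1 * t).
    apply: le_trans (_ : (B + d) * (B + d + 1) * (1 + t) <= _); first by nra.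
    rewrite -ler_pdivrMl; last by lra.
    by rewrite invf_div mulrA.
  have := ler_wpM2l (expR_ge0 t) f3; lra.
have qk : (q <= k)%N.
  rewrite -(ler_nat R); have k1 : 1 <= k%:R :> R by rewrite ler1n.
  have q0 : 0 <= q%:R :> R by [].
  nra.
have rho0 : 0 < rho by exact: expR_gt0.
exists m, k, q; split; split => //.
- have e3 : 1 - expR (- t) <= expR (- expR (- t)) by have := expR_ge1Dx (- expR (- t)); lra.
  have e4 : 0 <= 1 - expR (- t) by rewrite subr_ge0 expR_le1; lra.
  apply: le_trans (_ : expR (- expR (- t)) ^+ q <= _).
    by rewrite lerXn2r ?nnegrE ?expR_ge0.
  rewrite -expRM_natl /rho ler_expR mulrN lerN2.
  have := ler_wpM2r (expR_ge0 (- t)) qlt.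
  by rewrite -(mulrA _ (expR t)) expRxMexpNx_1 mulr1.
- apply: le_trans (_ : 4 * (expR (- (((h%:R - 1) / c + d) * t)) * X ^+ h.-1) <= _).
    by rewrite ler_wpM2l // ler_wpM2l ?expR_ge0 // lerXn2r ?nnegrE //; lra.
  rewrite /X -expRM_natl -expRD -subn1 natrB //.
  rewrite (_ : _ + _ = - ((d - d1 * h%:R + d1) * t)); last by field; rewrite gt_eqF.
  rewrite expRN d1h ler_pdivrMr ?expR_gt0 // mul1r.
  apply: le_trans (_ : 256 <= _); first by lra.
  by apply: le_trans (ltW e2) _; rewrite ler_expR; nra.
- have k1 : 1 <= k%:R :> R by rewrite ler1n.
  have r1 : rho ^+ (k - q) <= expR (- ((B + 3 / 4 * d) * t)) ^+ k.
    rewrite -!expRM_natl ler_expR !mulrN lerN2 natrB //.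
    rewrite !mulrA ler_wpM2r //; first by lra.
    by lra.
  (* Since [4 <= 4 ^ k], both sides are bounded by [k]-th powers and it suffices to compare
     bases. *)
  apply: le_lt_trans (_ : (4 * 8 * m%:R * expR (- ((B + 3 / 4 * d) * t))) ^+ k < _).
    rewrite !exprMn ler_pM // ?exprn_ge0 ?mulr_ge0 ?exprn_ge0 ?(ltW rho0) //.
    rewrite ler_wpM2r ?exprn_ge0 // ler_wpM2r ?exprn_ge0 // ler_eXnr //.
    by rewrite (ler_nat R 1 4).
  clear r1.
  rewrite ltrXn2r -?lt0n //.
  apply: le_lt_trans (_ : 32 * (X * expR (- ((B + 3 / 4 * d) * t))) < _).
    have := ler_wpM2r (expR_ge0 (- ((B + 3 / 4 * d) * t))) mX; lra.
  apply: lt_le_trans Zk; rewrite ltr_pdivlMr // /X -expRD.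
  apply: le_lt_trans (_ : 256 * expR (t - d / 2 * t) < _).
    rewrite (_ : 32 * _ * 8 = 256 * expR ((1 / c + d1) * t + - ((B + 3 / 4 * d) * t))); last by ring.
    rewrite ler_wpM2l // ler_expR /B; nra.
  apply: lt_le_trans Zt.
  rewrite expRD expRN mulrCA gtr_pMr ?expR_gt0 // ltr_pdivrMr ?expR_gt0 //; lra.
- move=> n /andP[n0 nm].
  have nR : 0 < n%:R :> R by rewrite ltr0n.
  apply: le_trans (half_le n%:R 2^-1 _ _); [|by apply/andP; split; lra|by []].
  (* The factor [n ^ (1 - c)] is at most [X ^ (1 - c)], which [rho] outweighs because [B] is
     [(1 - c) / c]. *)
  have nE : n%:R = n%:R `^ c * n%:R `^ (1 - c) :> R.
    rewrite -powRD ?(gt_eqF nR) ?implybT //.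
    by rewrite addrC subrK powRr1 // ltW.
  rewrite {1}nE mulrCA ler_wpM2l ?powR_ge0 //.
  have nX : n%:R `^ (1 - c) <= X `^ (1 - c).
    apply: ge0_ler_powR; rewrite ?nnegrE ?subr_ge0 //; first by lra.
    by apply: le_trans mX; rewrite ler_nat.
  apply: le_trans (ler_wpM2l (ltW rho0) nX) _.
  rewrite /X -expRM -expRD.
  rewrite (_ : _ + _ = - ((d - d1 * (1 - c)) * t)); last by rewrite /B; field; rewrite gt_eqF.
  rewrite expRN lef_pV2 ?posrE ?expR_gt0 //.
  apply: le_trans (_ : 256 <= _); first by lra.
  apply: le_trans (ltW e2) _; rewrite ler_expR; nra.
Qed.

(** * The dichotomy with a fixed error in the exponents *)

(** Both exponents share one error [d], so a single function can serve for both [o(1)] terms. *)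
Definition dichotomy {R : realType} (H : sgraph) (c eps d : R) : Prop :=
  forall G : sgraph,
    eps `^ ((#|H|%:R - 1) / c + d) * #|G|%:R ^+ #|H|
      <= #|induced_copies H G|%:R
    \/ exists S : {set G},
         eps_homogeneous eps S /\
         eps `^ (1 / c - 1 + d) * #|G|%:R <= #|S|%:R.

Lemma dichotomy_small_eps (R : realType) (H : sgraph) (c d : R) :
  (0 < #|H|)%N -> EH_property H c -> c <= 1 -> 0 < d ->
  exists2 e0 : R, 0 < e0 & forall eps, 0 < eps < e0 -> dichotomy H c eps d.
Proof.
move=> H0 EH c1 d0; have c0 : 0 < c by case: EH.
have cc : 0 < c <= 1 by apply/andP.
have [t0 ht0] := sampling_parameters R c d #|H| cc d0 H0.
pose t1 := Num.max t0 1.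
exists (expR (- t1)) => [|eps /andP[e0 e1]]; first exact: expR_gt0.
pose t := - ln eps.
have epsE : eps = expR (- t) by rewrite opprK lnK.
have tt : t1 < t by move: e1; rewrite epsE ltr_expR ltrN2.
have tt0 : t0 <= t by apply: le_trans (ltW tt); rewrite le_max lexx.
have t_gt0 : 0 < t by apply: lt_trans tt; rewrite lt_max ltr01 orbT.
have eps1 : eps < 1 by rewrite epsE expR_lt1; lra.
have powE a : eps `^ a = expR (- (a * t)) by rewrite epsE -expRM; congr expR; ring.
have [m [k [q [[m0 hk qk] [hq hN hlt hsmall]]]]] := ht0 t tt0.
move=> G; rewrite !powE.
set rho := expR (- ((1 / c - 1 + d) * t)) in hq hlt hsmall *.
set E := expR (- _) in hN *.
set n := #|G|; set h := #|H| in H0 hN *; set N := #|induced_copies H G|.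
have [n0|n0] := posnP n.
  by left; rewrite n0 expr0n gtn_eqF // mulr0.
have [hle|few] := leP (E * n%:R ^+ h) N%:R; [by left|right].
apply: contrapT => noS.
have {}noS (S : {set G}) : eps_homogeneous eps S -> #|S|%:R < rho * n%:R.
  by move=> hS; rewrite ltNge; apply/negP => hle; apply: noS; exists S.
have copies_le : (4 * (N * m ^ h.-1) <= n ^ h)%N.
  rewrite -(ler_nat R) !natrM !natrX.
  apply: le_trans (_ : n%:R ^+ h * (4 * (E * m%:R ^+ h.-1)) <= _); last first.
    by rewrite ger_pMr // exprn_gt0 // ltr0n.
  rewrite [leRHS]mulrCA ler_wpM2l // mulrA ler_wpM2r ?exprn_ge0 //.
  by rewrite mulrC ltW.
have [mn|nm] := leqP m n.
  have mn' : (0 < m <= #|G|)%N by rewrite m0.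
  have e01 : 0 < eps < 1 by rewrite e0.
  rewrite -epsE in hq.
  have := no_large_eps_homogeneous_bound R H c eps rho G m k q H0 EH mn'
    copies_le hk qk e01 hq.
  rewrite leNgt hlt => bound; suff : false by [].
  by apply: bound => S hS1 hS2; move: hS1; rewrite ltNge ltW // noS.
have [S [_ hS cS]] := few_copies_homogeneous R H c G finset.setT H0 EH.
have := noS _ (homogeneous_eps_homogeneous _ _ _ _ e0 hS).
rewrite ltNge => /negP[]; apply: le_trans (hsmall n _) _; first by rewrite n0 ltnW.
apply: le_trans cS.
have cN : (#|copies_in H [set: G]%SET| <= N)%N.
  by rewrite subset_leq_card //; apply/fintype.subsetP => U; rewrite inE => /andP[].
(* Here [n < m], so [4 * N * m ^ (h - 1) <= n ^ h <= n * m ^ (h - 1)]; deletion in [G] itself keeps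
   at least half of the vertices. *)
have N4 : (4 * N <= n)%N.
  rewrite -(leq_pmul2r (_ : 0 < m ^ h.-1)%N) ?expn_gt0 ?m0 //.
  rewrite -mulnA; apply: (leq_trans copies_le).
  rewrite -{1}(prednK H0) expnS leq_mul2l; apply/orP; right.
  by elim: h.-1 => // j IH; rewrite !expnS leq_mul // ltnW.
apply: ge0_ler_powR; rewrite ?nnegrE ?divr_ge0 ?(ltW c0) //.
rewrite ler_pdivrMr // -[2]/(2%:R) -natrM ler_nat cardsT -/n.
by clear -cN N4; move: cN N4; set x := #|_|; lia.
Qed.

(** The result for a smaller [eps1] is transferred to [eps]: an [eps1]-homogeneous set is
    [eps]-homogeneous, and a large [d] absorbs the change of base. *)
Lemma dichotomy_exists (R : realType) (H : sgraph) (c eps : R) :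
  (0 < #|H|)%N -> EH_property H c -> c <= 1 -> 0 < eps < 1 ->
  exists2 d : R, 0 < d & dichotomy H c eps d.
Proof.
move=> H0 EH c1 /andP[e0 e1]; have c0 : 0 < c by case: EH.
have [e2 e20 he2] := dichotomy_small_eps R H c 1 H0 EH c1 ltr01.
pose eps1 := Num.min (e2 / 2) eps.
have eps10 : 0 < eps1 by rewrite lt_min e0 divr_gt0.
have eps1e : eps1 <= eps by rewrite ge_min lexx orbT.
have eps1e2 : eps1 < e2.
  by apply: le_lt_trans (_ : e2 / 2 < _); [rewrite ge_min lexx|lra].
have {he2} dich : dichotomy H c eps1 1 by apply: he2; rewrite eps10.
set A := (#|H|%:R - 1) / c in dich *; set B := 1 / c - 1 in dich *.
have A0 : 0 <= A by rewrite divr_ge0 ?subr_ge0 ?ler1n ?(ltW c0).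
have B0 : 0 <= B by rewrite subr_ge0 ler_pdivlMr // mul1r.
pose t := - ln eps; pose t1 := - ln eps1.
have epsE : eps = expR (- t) by rewrite opprK lnK.
have eps1E : eps1 = expR (- t1) by rewrite opprK lnK.
have tt0 : 0 < t by move: e1; rewrite epsE expR_lt1; lra.
have tt1 : t <= t1 by move: eps1e; rewrite epsE eps1E ler_expR; lra.
(* Chosen so that [eps ^ d = eps1 ^ (A + B + 1)]. *)
pose d := (A + B + 1) * t1 / t.
have dt : d * t = (A + B + 1) * t1 by rewrite /d mulfVK // gt_eqF.
have pow_le a : 0 <= a <= A + B -> eps `^ (a + d) <= eps1 `^ (a + 1).
  move=> /andP[a0 aAB]; rewrite epsE eps1E -!expRM ler_expR; nra.
exists d => [|G].
  by rewrite /d divr_gt0 ?mulr_gt0 //; lra.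
have [h|[S [hS cS]]] := dich G; [left|right].
  by apply: le_trans h; rewrite ler_wpM2r ?exprn_ge0 // pow_le // A0 lerDl B0.
exists S; split; last first.
  by apply: le_trans cS; rewrite ler_wpM2r // pow_le // B0 lerDr A0.
by case: hS => hS; [left; exact: le_trans hS _|right; apply: le_trans hS; lra].
Qed.

(** * Error terms tending to zero *)

(** [f e] is an admissible value within [e] of the infimum of all admissible ones, as the infimum
    need not be attained. Once [d / 2] is admissible and [e < d / 2], it follows that [f e < d]. *)
Lemma cvg0_right_choice (R : realType) (P : R -> R -> Prop) :
  (forall d, 0 < d -> exists2 e0, 0 < e0 & forall e, 0 < e < e0 -> P e d) ->
  (forall e, 0 < e < 1 -> exists2 d, 0 < d & P e d) ->
  exists f : R -> R, (f x @[x --> 0^'+] --> (0 : R))%classic /\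
    forall e, 0 < e < 1 -> P e (f e).
Proof.
move=> Psmall Pex.
have /choice [f hf] : forall e, exists y, 0 < e < 1 ->
    [/\ 0 < y, P e y & forall d, 0 < d -> P e d -> y < d + e].
  move=> e; have [e01|] := boolP (0 < e < 1); last by exists 0.
  have /andP[e0 _] := e01.
  pose E := [set d : R | 0 < d /\ P e d]%classic.
  have hE : has_inf E.
    split; first by have [d d0 Pd] := Pex e e01; exists d.
    by exists 0 => d [/ltW].
  have [y [y0 Py] yE] := inf_adherent e0 hE.
  exists y => _; split => // d d0 Pd; apply: (lt_le_trans yE).
  by rewrite lerD2r; apply: ge_inf; [case: hE|].
exists f; split => [|e /hf[]//].
apply/cvgr0Pnorm_lt => d d0.
have d2 : 0 < d / 2 by rewrite divr_gt0.
have [e0 e00 he0] := Psmall _ d2.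
near=> x.
have x0 : 0 < x by [].
have x1 : x < 1 by near: x; exact: nbhs_right_lt.
have xe0 : x < e0 by near: x; exact: nbhs_right_lt.
have xd : x < d / 2 by near: x; exact: nbhs_right_lt.
have [fx0 _ fx] := hf x (introT andP (conj x0 x1)).
have := fx _ d2 (he0 x (introT andP (conj x0 xe0))).
rewrite gtr0_norm //; lra.
Unshelve. all: by end_near. Qed.

(** * The exponent bound and the one-vertex case *)

(** The test graph has two vertices, adjacent exactly when [x] and [y] are not. It cannot contain
    [H], so [2 ^ c <= 2]. *)
Lemma EH_exponent_le1 (R : realType) (H : sgraph) (c : R) :
  (1 < #|H|)%N -> EH_property H c -> c <= 1.
Proof.
move=> /card_gt1P[x [y [_ _ xy]]] [c0 EH].
have sym (b : bool) : symmetric (fun u v : bool => b && (u != v)).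
  by move=> u v; rewrite eq_sym.
have irr (b : bool) : irreflexive (fun u v : bool => b && (u != v)).
  by move=> u; rewrite eqxx andbF.
pose G : sgraph := SGraph (sym (~~ adj x y)) (irr (~~ adj x y)).
have free : induced_free H G.
  move=> U; apply/negP => /is_induced_copyP[f [fi fa _]].
  by have := fa x y; rewrite /= (inj_eq fi) xy andbT; case: (adj x y).
have hG : (Defs.hom G <= 2)%N.
  by apply/bigmax_leqP => S _; rewrite -card_bool max_card.
have := EH G free; rewrite card_bool => h.
have {}h : 2 `^ c <= 2 :> R by apply: le_trans h _; rewrite ler_nat.
have l2 : 0 < ln 2 :> R by rewrite ln_gt0 // ltr1n.
have e2 : expR (ln 2) = 2 :> R by rewrite lnK // posrE.
by move: h; rewrite -{1 2}e2 -expRM ler_expR -{2}[ln 2]mulr1 ler_pM2l.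
Qed.

Lemma card_le_copies_single (H G : sgraph) :
  #|H| = 1%N -> (#|G| <= #|induced_copies H G|)%N.
Proof.
move=> H1; have /fintype_le1P Hle : (#|H| <= 1)%N by rewrite H1.
have /card_gt0P[x0 _] : (0 < #|H|)%N by rewrite H1.
rewrite -cardsT -(card_imset _ (@finset.set1_inj G)) subset_leq_card //.
apply/fintype.subsetP => _ /imsetP[v _ ->]; rewrite inE.
apply/is_induced_copyP; exists (fun=> v); split.
- by move=> x y _; exact: Hle.
- by move=> x y; rewrite (Hle x y) !adj_irr.
- by apply/setP => u; rewrite inE; apply/eqP/imsetP => [->|[]//]; exists x0.
Qed.

Local Open Scope classical_set_scope.

Theorem theorem1p5 (R : realType) (H : sgraph) (c : R) :
  (0 < #|H|)%N ->
  EH_property H c ->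
  exists f g : R -> R,
    [/\ f x @[x --> 0^'+] --> (0 : R),
        g x @[x --> 0^'+] --> (0 : R)
      & forall eps : R, 0 < eps -> eps < 1 ->
        forall G : sgraph,
          eps `^ ((#|H|%:R - 1) / c + f eps) * #|G|%:R ^+ #|H|
            <= #|induced_copies H G|%:R
          \/ exists S : {set G},
               eps_homogeneous eps S /\
               eps `^ (1 / c - 1 + g eps) * #|G|%:R <= #|S|%:R].
Proof.
move=> H0 EH; case: (ltngtP #|H| 1) => [|H2|H1]; first by rewrite ltnNge H0.
  have c1 := EH_exponent_le1 R H c H2 EH.
  have [f [f0 hf]] := cvg0_right_choice R (dichotomy H c)
    (fun d => dichotomy_small_eps R H c d H0 EH c1)
    (fun e => dichotomy_exists R H c e H0 EH c1).
  by exists f, f; split => // eps e0 e1; apply: hf; rewrite e0.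
(* For one-vertex [H] only the empty graph is [H]-free, so [c] may exceed 1. The first exponent is
   then 0 and every vertex gives a copy. *)
exists (fun=> 0), (fun=> 0); split; [exact: cvg_cst|exact: cvg_cst|].
move=> eps e0 e1 G; left; rewrite H1 subrr mul0r addr0 powRr0 mul1r expr1 ler_nat.
exact: card_le_copies_single.
Qed.
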